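(* Let $d\ge 2$. There exist a function $\phi:\mathbb{R}^d\times\mathbb{R}^d\to\mathbb{R}$ and a number $t\in\mathbb{R}$ such that $\phi$ satisfies the Phong-Stein rotational curvature condition at $t$ and the following holds: for every $0\le s<\frac{d+1}{2}$ there exists a compact set $E\subset\mathbb{R}^d$ of Hausdorff dimension $s$ such that $$\overline{\dim}_{\mathcal M}\{(x,y)\in E\times E:\ \phi(x,y)=t\}>2\dim_{\mathcal H}(E)-1 .$$
   Context: $\dim_{\mathcal H}$ is Hausdorff dimension and $\overline{\dim}_{\mathcal M}$ is upper Minkowski (box) dimension, with the convention that the empty set has upper Minkowski dimension $-\infty$. Phong-Stein rotational curvature condition at $t$: $\phi$ is smooth in a neighborhood of $\{(x,y):\phi(x,y)=t\}$ and $$\det\begin{pmatrix} 0 & \nabla_x\phi\\ -(\nabla_y\phi)^T & \frac{\partial^2\phi}{\partial x_i\,\partial y_j}\end{pmatrix}\ne 0\quad\text{on the set }\{(x,y):\phi(x,y)=t\},$$ where the matrix is of size $(d+1)\times(d+1)$. *)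

(* Defs.v *)
From HB Require Import structures.
From mathcomp Require Import all_boot all_order all_algebra.
From mathcomp Require Import all_classical all_reals all_analysis.

Set Implicit Arguments.
Unset Strict Implicit.
Unset Printing Implicit Defensive.

Import Order.TTheory GRing.Theory Num.Theory.
Import numFieldNormedType.Exports.

Local Open Scope classical_set_scope.
Local Open Scope ring_scope.

(* The library norm on 'rV[R]_n is the sup norm; it is used below only through
   the topology it induces. Distances are Euclidean. *)
Definition edist (R : realType) (n : nat) (x y : 'rV[R]_n) : R :=
  Num.sqrt (\sum_(i < n) (x 0 i - y 0 i) ^+ 2).

Definition diam (R : realType) (n : nat) (A : set 'rV[R]_n) : \bar R :=
  ereal_sup [set (edist x y)%:E | x in A & y in A].

(* The empty set is treated apart so that it contributes 0 also when s = 0;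
   a singleton contributes 0 `^ s, i.e. 1 if s = 0 and 0 if s > 0. *)
Definition hausdorff_gauge (R : realType) (n : nat) (s : R)
    (A : set 'rV[R]_n) : \bar R :=
  (if `[< A = set0 >] then 0 else diam A `^ s)%E.

Definition hausdorff_premeasure (R : realType) (n : nat) (s delta : R)
    (A : set 'rV[R]_n) : \bar R :=
  ereal_inf [set (\sum_(0 <= i <oo) hausdorff_gauge s (U i))%E
            | U in [set U : nat -> set 'rV[R]_n |
                     A `<=` \bigcup_i U i /\
                     forall i, (diam (U i) <= delta%:E)%E]].

(* The premeasure is nonincreasing in delta: its limit as delta -> 0+ is its
   supremum. *)
Definition hausdorff_measure (R : realType) (n : nat) (s : R)
    (A : set 'rV[R]_n) : \bar R :=
  ereal_sup [set hausdorff_premeasure s delta A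
            | delta in [set delta : R | 0 < delta]].

Definition hausdorff_dim (R : realType) (n : nat) (A : set 'rV[R]_n) : \bar R :=
  ereal_inf [set s%:E | s in [set s : R | 0 <= s /\ hausdorff_measure s A = 0%E]].

(* Least number of closed Euclidean delta-balls covering A (+oo if no finite
   family does). *)
Definition covering_number (R : realType) (n : nat) (A : set 'rV[R]_n)
    (delta : R) : \bar R :=
  ereal_inf [set ((size c)%:R)%:E
            | c in [set c : seq 'rV[R]_n |
                     A `<=` [set x | exists2 y, y \in c & edist x y <= delta]]].

(* limsup of log N(A, delta) / log (1 / delta) as delta -> 0+. As lne 0 = -oo,
   this is -oo when A is empty. *)
Definition upper_minkowski_dim (R : realType) (n : nat)
    (A : set 'rV[R]_n) : \bar R :=
  limf_esup (fun delta : R =>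
    (lne (covering_number A delta) / lne (delta^-1)%:E)%E) (0^'+).

Definition evec (R : realType) (n : nat) (i : 'I_n) : 'rV[R]_n := delta_mx 0 i.

Fixpoint Ck_on (R : realType) (n k : nat) (U : set 'rV[R]_n)
    (f : 'rV[R]_n -> R) : Prop :=
  (forall z, U z -> {for z, continuous f}) /\
  (if k is k'.+1 then
     forall i : 'I_n, (forall z, U z -> derivable f z (evec R i)) /\
                      Ck_on k' U ('D_(evec R i) f)
   else True).

Definition smooth_on (R : realType) (n : nat) (U : set 'rV[R]_n)
    (f : 'rV[R]_n -> R) : Prop :=
  forall k, Ck_on k U f.

(* Points (x, y) of R^d x R^d are identified with row_mx x y in R^(d + d). *)
Definition uncurry_row (R : realType) (d : nat)
    (phi : 'rV[R]_d -> 'rV[R]_d -> R) (z : 'rV[R]_(d + d)) : R :=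
  phi (lsubmx z) (rsubmx z).

Definition grad_x (R : realType) (d : nat) (phi : 'rV[R]_d -> 'rV[R]_d -> R)
    (x y : 'rV[R]_d) : 'rV[R]_d :=
  \row_i 'D_(evec R i) (fun x' => phi x' y) x.

Definition grad_y (R : realType) (d : nat) (phi : 'rV[R]_d -> 'rV[R]_d -> R)
    (x y : 'rV[R]_d) : 'rV[R]_d :=
  \row_j 'D_(evec R j) (fun y' => phi x y') y.

Definition mixed_hessian (R : realType) (d : nat)
    (phi : 'rV[R]_d -> 'rV[R]_d -> R) (x y : 'rV[R]_d) : 'M[R]_d :=
  \matrix_(i, j)
    'D_(evec R i) (fun x' => 'D_(evec R j) (fun y' => phi x' y') y) x.

Definition rotational_matrix (R : realType) (d : nat)
    (phi : 'rV[R]_d -> 'rV[R]_d -> R) (x y : 'rV[R]_d) : 'M[R]_(1 + d) :=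
  block_mx 0                      (grad_x phi x y)
           (- (grad_y phi x y)^T) (mixed_hessian phi x y).

Definition rotational_curvature (R : realType) (d : nat)
    (phi : 'rV[R]_d -> 'rV[R]_d -> R) (t : R) : Prop :=
  (exists U : set 'rV[R]_(d + d),
     [/\ open U, [set z | uncurry_row phi z = t] `<=` U
       & smooth_on U (uncurry_row phi)]) /\
  (forall x y, phi x y = t -> \det (rotational_matrix phi x y) != 0).

Definition incidence_set (R : realType) (d : nat)
    (phi : 'rV[R]_d -> 'rV[R]_d -> R) (t : R) (E : set 'rV[R]_d) :
    set 'rV[R]_(d + d) :=
  [set row_mx p.1 p.2 | p in [set p | E p.1 /\ E p.2 /\ phi p.1 p.2 = t]].

(* Main.v *)
Require Import Defs.
From mathcomp Require Import all_boot all_order all_algebra.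
From mathcomp Require Import all_classical all_reals all_analysis.
From mathcomp Require Import ring lra zify.
Import Order.TTheory GRing.Theory Num.Theory.
Import numFieldNormedType.Exports.
Local Open Scope classical_set_scope.
Local Open Scope ring_scope.

(** Take phi(x, y) = x . y and t = 1: the determinant of the rotational matrix
    of the dot product at (x, y) is x . y itself. Upper Minkowski dimension sees
    countable compact sets and Hausdorff dimension does not, so let
    E = C `|` K `|` f(K), where C is a self-similar Cantor set of Hausdorff
    dimension s, K is a countable compact union of finite grids of upper
    Minkowski dimension d, and f(x) = e_0 / x_0, which satisfies x . f(x) = 1.
    The incidence set of E contains the graph of f over K, so its upper
    Minkowski dimension is at least d > 2 s - 1. *)

(* The analysis library has another edist, the extended distance of a
   pseudometric space. *)
Local Notation edist := Defs.edist.

(** * Rotational curvature of the dot product *)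

(** [Ck_on] at order k + 1 asks for [Ck_on] at order k of every partial derivative, so smoothness is
    proved for a whole class of functions closed under differentiation. *)
Inductive polynomial_fun (R : realType) (n : nat) : ('rV[R]_n -> R) -> Prop :=
| polynomial_cst c : polynomial_fun R n (fun _ => c)
| polynomial_coord i : polynomial_fun R n (fun z => z 0 i)
| polynomial_add f g : polynomial_fun R n f -> polynomial_fun R n g ->
    polynomial_fun R n (f \+ g)
| polynomial_mul f g : polynomial_fun R n f -> polynomial_fun R n g ->
    polynomial_fun R n (f \* g).

Lemma polynomial_fun_sum (R : realType) (n : nat) (I : Type) (r : seq I)
    (F : I -> 'rV[R]_n -> R) :
  (forall i, polynomial_fun R n (F i)) ->
  polynomial_fun R n (fun z => \sum_(i <- r) F i z).
Proof.
move=> pF; elim: r => [|i r IH].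
  by under eq_fun do rewrite big_nil; exact: polynomial_cst.
by under eq_fun do rewrite big_cons; exact: polynomial_add.
Qed.

(** The difference quotient is constantly [f v] for nonzero [h]. *)
Lemma is_derive_linear_form (R : realType) (n : nat) (f : 'rV[R]_n -> R)
    (z v : 'rV[R]_n) :
  (forall h, f (h *: v + z) = h * f v + f z) -> is_derive z v f (f v).
Proof.
move=> flin.
have H : (h^-1 *: (f (h *: v + z) - f z)) @[h --> 0^'] --> f v.
  apply: (@cvg_trans _ ((fun=> f v) h @[h --> (0:R)^'])); last exact: cvg_cst.
  apply: near_eq_cvg; near=> h.
  rewrite flin addrK /GRing.scale/= mulKf//.
  by near: h; exact: nbhs_dnbhs_neq.
split; first by apply/cvg_ex; exists (f v).
exact: cvg_lim.
Unshelve. all: by end_near. Qed.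

Lemma polynomial_fun_derive (R : realType) (n : nat) (f : 'rV[R]_n -> R)
    (v : 'rV[R]_n) :
  polynomial_fun R n f ->
  exists2 g, polynomial_fun R n g & forall z, is_derive z v f (g z).
Proof.
elim=> [c|i|{}f g pf [f' pf' df] pg [g' pg' dg]|{}f g pf [f' pf' df] pg [g' pg' dg]].
- by exists (fun=> 0); [exact: polynomial_cst|move=> z; exact: is_derive_cst].
- exists (fun=> v 0 i); first exact: polynomial_cst.
  by move=> z; apply: is_derive_linear_form => h; rewrite !mxE.
- exists (f' \+ g'); first exact: polynomial_add.
  by move=> z; exact: is_deriveD.
- exists ((f \* g') \+ (g \* f')).
    by apply: polynomial_add; exact: polynomial_mul.
  by move=> z; exact: is_deriveM.
Qed.

Lemma polynomial_fun_continuous (R : realType) (n : nat) (f : 'rV[R]_n -> R) :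
  polynomial_fun R n f -> continuous f.
Proof.
elim=> [c|i|{}f g _ cf _ cg|{}f g _ cf _ cg] z.
- exact: cst_continuous.
- exact: coord_continuous.
- exact: (continuousD (cf z) (cg z)).
- exact: (continuousM (cf z) (cg z)).
Qed.

Lemma polynomial_fun_smooth (R : realType) (n : nat) (f : 'rV[R]_n -> R) :
  polynomial_fun R n f -> smooth_on setT f.
Proof.
move=> pf k; elim: k f pf => [|k IH] f pf; split=> //.
- by move=> z _; exact: polynomial_fun_continuous.
- by move=> z _; exact: polynomial_fun_continuous.
- move=> i; have [g pg dg] := polynomial_fun_derive R n f (evec R i) pf.
  split; first by move=> z _; have [] := dg z.
  suff -> : 'D_(evec R i) f = g by exact: IH.
  by apply/funext => z; have [_ ->] := dg z.
Qed.

Definition dot {R : realType} {d : nat} (x y : 'rV[R]_d) : R :=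
  \sum_(i < d) x 0 i * y 0 i.

Lemma dotC (R : realType) (d : nat) (x y : 'rV[R]_d) : dot x y = dot y x.
Proof. by apply: eq_bigr => i _; rewrite mulrC. Qed.

Lemma dot_evec (R : realType) (d : nat) (x : 'rV[R]_d) i :
  dot (evec R i) x = x 0 i.
Proof.
rewrite /dot (bigD1 i)//= big1 ?addr0 => [|j ji].
  by rewrite !mxE !eqxx mul1r.
by rewrite !mxE eqxx (negbTE ji) mul0r.
Qed.

Lemma derive_dotl (R : realType) (d : nat) (x y v : 'rV[R]_d) :
  'D_v ((dot)^~ y) x = dot v y.
Proof.
suff [_ ->//] : is_derive x v ((dot)^~ y) (dot v y) by [].
apply: is_derive_linear_form => h.
rewrite /dot mulr_sumr -big_split/=; apply: eq_bigr => i _.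
by rewrite !mxE mulrDl mulrA.
Qed.

Lemma derive_dotr (R : realType) (d : nat) (x y v : 'rV[R]_d) :
  'D_v (dot x) y = dot x v.
Proof.
rewrite [RHS]dotC -(derive_dotl R d y x v); congr ('D_v _ _).
by apply/funext => z; rewrite dotC.
Qed.

Lemma rotational_matrix_dot (R : realType) (d : nat) (x y : 'rV[R]_d) :
  rotational_matrix (dot) x y = block_mx 0 y (- x^T) 1%:M.
Proof.
congr block_mx.
- by apply/rowP => i; rewrite mxE derive_dotl dot_evec.
- by congr (- _^T); apply/rowP => i; rewrite mxE derive_dotr dotC dot_evec.
- apply/matrixP => i j; rewrite mxE.
  under [X in 'D__ X _]eq_fun do rewrite derive_dotr.
  by rewrite derive_dotl dot_evec !mxE eqxx eq_sym.
Qed.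

(** Elimination against the identity block: the matrix is a product of two block triangular ones,
    and the Schur complement [y *m x^T] is the only diagonal block other than an identity. *)
Lemma det_rotational_matrix_dot (R : realType) (d : nat) (x y : 'rV[R]_d) :
  \det (rotational_matrix (dot) x y) = dot x y.
Proof.
have -> : rotational_matrix (dot) x y =
    block_mx (y *m x^T) y 0 1%:M *m block_mx 1%:M 0 (- x^T) 1%:M.
  rewrite mulmx_block rotational_matrix_dot !mulmx1 !mulmx0 !add0r.
  by rewrite mulmxN subrr mul1mx.
rewrite det_mulmx det_ublock det_lblock !det1 !mulr1 det_mx11 mxE dotC.
by apply: eq_bigr => i _; rewrite mxE.
Qed.

Lemma rotational_curvature_dot (R : realType) (d : nat) :
  rotational_curvature (@dot R d) 1.
Proof.
split; last by move=> x y xy; rewrite det_rotational_matrix_dot xy oner_neq0.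
exists setT; split=> //; first exact: openT.
apply: polynomial_fun_smooth.
have -> : uncurry_row (@dot R d) =
    (fun z => \sum_(i < d) z 0 (lshift d i) * z 0 (rshift d i)).
  by apply/funext => z; apply: eq_bigr => i _; rewrite !mxE.
apply: polynomial_fun_sum => i.
by apply: polynomial_mul; exact: polynomial_coord.
Qed.

(** * Bounds for the Hausdorff dimension *)

Lemma edist_ge0 (R : realType) (n : nat) (x y : 'rV[R]_n) : 0 <= edist x y.
Proof. exact: sqrtr_ge0. Qed.

Lemma coord_le_edist (R : realType) (n : nat) (x y : 'rV[R]_n) i :
  `|x 0 i - y 0 i| <= edist x y.
Proof.
rewrite /edist -sqrtr_sqr ler_wsqrtr// (bigD1 i)//= lerDl.
by apply: sumr_ge0 => j _; exact: sqr_ge0.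
Qed.

(** The sharp factor is the square root of [n]; the cruder [n] is enough, as constants do not affect
    dimensions. *)
Lemma edist_le (R : realType) (n : nat) (x y : 'rV[R]_n) (e : R) :
  0 <= e -> (forall i, `|x 0 i - y 0 i| <= e) -> edist x y <= n%:R * e.
Proof.
move=> e0 xye; rewrite /edist -(@ger0_norm _ (n%:R * e)) ?mulr_ge0//.
rewrite -sqrtr_sqr ler_wsqrtr// exprMn.
apply: (@le_trans _ _ (n%:R * e ^+ 2)).
  rewrite mulr_natl -[X in _ <= _ *+ X]card_ord -sumr_const.
  by apply: ler_sum => i _; rewrite -real_normK ?num_real// lerXn2r// nnegrE.
rewrite ler_wpM2r ?sqr_ge0// -natrX ler_nat.
by case: n {x y xye} => // n; rewrite leq_pmull.
Qed.

Lemma edistxx (R : realType) (n : nat) (x : 'rV[R]_n) : edist x x = 0.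
Proof. by rewrite /edist big1 ?sqrtr0// => i _; rewrite subrr expr0n. Qed.

Lemma diam_le (R : realType) (n : nat) (A : set 'rV[R]_n) (D : R) :
  (forall x y, A x -> A y -> edist x y <= D) -> (diam A <= D%:E)%E.
Proof.
by move=> AD; apply: ge_ereal_sup => _ /= [x Ax [y Ay <-]]; rewrite lee_fin AD.
Qed.

Lemma edist_le_diam (R : realType) (n : nat) (A : set 'rV[R]_n) x y :
  A x -> A y -> ((edist x y)%:E <= diam A)%E.
Proof. by move=> Ax Ay; apply: ereal_sup_ubound; exists x => //; exists y. Qed.

Lemma hausdorff_gauge_ge0 (R : realType) (n : nat) (s : R) (A : set 'rV[R]_n) :
  (0 <= hausdorff_gauge s A)%E.
Proof. by rewrite /hausdorff_gauge; case: ifP => // _; exact: poweR_ge0. Qed.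

Lemma hausdorff_gauge_le (R : realType) (n : nat) (s D : R) (A : set 'rV[R]_n) :
  0 <= s -> 0 <= D -> (forall x y, A x -> A y -> edist x y <= D) ->
  (hausdorff_gauge s A <= (D `^ s)%:E)%E.
Proof.
move=> s0 D0 AD; rewrite /hausdorff_gauge; case: asboolP => [_|/eqP/set0P[x Ax]].
  by rewrite lee_fin powR_ge0.
have d0 : (0 <= diam A)%E.
  by apply: le_trans (edist_le_diam R n A x x Ax Ax); rewrite lee_fin edist_ge0.
rewrite -poweR_EFin gt0_ler_poweR//.
- by rewrite in_itv/= d0 leey.
- by rewrite in_itv/= lee_fin D0 leey.
- exact: diam_le.
Qed.

(** The points of [B] are covered by singletons, which cost nothing because s > 0. Only the finitely
    many sets [V i] contribute. *)
Lemma hausdorff_measure_eq0 (R : realType) (n : nat) (s : R) (A B : set 'rV[R]_n) :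
  0 < s -> countable B ->
  (forall delta e : R, 0 < delta -> 0 < e ->
    exists N (V : nat -> set 'rV[R]_n) (D : R),
    [/\ A `<=` \bigcup_(i in `I_N) V i `|` B,
        forall i, (i < N)%N -> forall x y, V i x -> V i y -> edist x y <= D,
        0 <= D, D <= delta & N%:R * D `^ s <= e]) ->
  hausdorff_measure s A = 0%E.
Proof.
move=> s0 /countable_injP[g ginj] cov.
apply/eqP; rewrite eq_le; apply/andP; split; last first.
  apply: le_ereal_sup_tmp; exists (hausdorff_premeasure s 1 A);
    first by exists 1 => //=; exact: ltr01.
  apply: le_ereal_inf_tmp => _ [U _ <-].
  by apply: nneseries_ge0 => *; exact: hausdorff_gauge_ge0.
apply: ge_ereal_sup => _ [delta /= delta0 <-].
apply/lee_addgt0Pr => e e0; rewrite add0e.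
have [N [V [D [AV VD D0 Ddelta Ne]]]] := cov delta e delta0 e0.
(* Indices from [N] on carry the fibres of the injection [g], each with at most one point. *)
pose U i := if (i < N)%N then V i else [set x | B x /\ (g x + N)%N = i].
have UD i x y : U i x -> U i y -> edist x y <= if (i < N)%N then D else 0.
  rewrite /U; case: ifPn => iN; first exact: VD.
  move=> [Bx gx] [By gy]; rewrite (_ : x = y) ?edistxx//.
  by apply: ginj; rewrite ?inE//; apply/eqP; rewrite -(eqn_add2r N) gx gy.
apply: ge_ereal_inf; exists (\sum_(0 <= i <oo) hausdorff_gauge s (U i))%E.
  exists U => //; split.
    move=> x /AV[[i /= iN Vix]|Bx]; first by exists i => //; rewrite /U iN.
    by exists (g x + N)%N => //; rewrite /U ltnNge leq_addl.
  move=> i; apply: diam_le => x y Ux Uy; apply: (le_trans (UD i x y Ux Uy)).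
  by case: ifP => // _; exact: ltW.
rewrite (@nneseries_split _ _ 0%N N)//; last by move=> *; exact: hausdorff_gauge_ge0.
rewrite [X in (_ + X)%E]eseries0 ?adde0 => [|i Ni _]; last first.
  apply/eqP; rewrite eq_le hausdorff_gauge_ge0 andbT.
  apply: (@le_trans _ _ (0 `^ s)%:E); last by rewrite powR0// gt_eqF.
  apply: hausdorff_gauge_le => // [|x y Ux Uy]; first exact: ltW.
  by have := UD _ _ _ Ux Uy; rewrite ltnNge Ni.
apply: (@le_trans _ _ (N%:R * D `^ s)%:E); last by rewrite lee_fin.
rewrite add0n big_mkord mulr_natl -[X in (_ *+ X)%:E]card_ord -sumr_const -sumEFin.
apply: lee_sum => i _; apply: hausdorff_gauge_le => //; first exact: ltW.
by move=> x y Ux Uy; have := UD _ _ _ Ux Uy; rewrite ltn_ord.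
Qed.

Lemma hausdorff_dim_le (R : realType) (n : nat) (s : R) (A : set 'rV[R]_n) :
  0 <= s -> (forall s', s < s' -> hausdorff_measure s' A = 0%E) ->
  (hausdorff_dim A <= s%:E)%E.
Proof.
move=> s0 sA; apply/lee_addgt0Pr => e e0; apply: ereal_inf_lbound.
have ss : s < s + e by rewrite ltrDl.
by exists (s + e) => //; split; [exact: ltW (le_lt_trans s0 ss)|exact: sA].
Qed.

Lemma hausdorff_dim_ge0 (R : realType) (n : nat) (A : set 'rV[R]_n) :
  (0 <= hausdorff_dim A)%E.
Proof. by apply: le_ereal_inf_tmp => _ [s [s0 _] <-]; rewrite lee_fin. Qed.

(* The sets G^-1 U_i cover the unit interval and have length at most twice
   c (diam U_i) ^ s, so the sum of the (diam U_i) ^ s is bounded below. *)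
Lemma hausdorff_dim_ge (R : realType) (n : nat) (s c : R) (A : set 'rV[R]_n)
    (G : R -> 'rV[R]_n) :
  0 < s -> 0 < c ->
  (forall x, 0 <= x < 1 -> A (G x)) ->
  (forall x y, 0 <= x < 1 -> 0 <= y < 1 -> `|x - y| <= c * edist (G x) (G y) `^ s) ->
  (s%:E <= hausdorff_dim A)%E.
Proof.
move=> s0 c0 GA Gc; apply: le_ereal_inf_tmp => _ [s' [s'0 As'] <-].
rewrite lee_fin leNgt; apply/negP => s's.
have c2 : 0 < 2 * c by rewrite mulr_gt0.
(* Scale 1 keeps all diameters at most 1, so that lowering the exponent from [s] to [s'] can only
   increase their powers. *)
have : (hausdorff_premeasure s' 1 A < (2 * c)^-1%:E)%E.
  apply: (@le_lt_trans _ _ 0%E); last by rewrite lte_fin invr_gt0.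
  by rewrite -As'; apply: ereal_sup_ubound; exists 1 => //=; exact: ltr01.
move=> /ereal_inf_lt[_ [U [AU U1] <-]] Uc.
(* The preimage of [U i] need not be measurable. It is enclosed in [W i]: the empty set, or an
   interval centred at one of its points. *)
have [W HW] : {W : nat -> set R & forall i, [/\ measurable (W i),
    forall x, 0 <= x < 1 -> U i (G x) -> W i x &
    (lebesgue_measure (W i) <= (2 * c)%:E * hausdorff_gauge s' (U i))%E]}.
  apply: (@choice _ _ (fun i W => [/\ measurable W,
    forall x, 0 <= x < 1 -> U i (G x) -> W x &
    (lebesgue_measure W <= (2 * c)%:E * hausdorff_gauge s' (U i))%E])) => i.
  have [[x0 [x001 Ux0]]|nex] := pselect (exists x, 0 <= x < 1 /\ U i (G x)); last first.
    exists set0; split => //; first by move=> x x01 Ux; apply: nex; exists x.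
    by rewrite measure0 mule_ge0 ?hausdorff_gauge_ge0// lee_fin ltW.
  have d0 : (0 <= diam (U i))%E.
    by apply: le_trans (edist_le_diam R n _ _ _ Ux0 Ux0); rewrite lee_fin edist_ge0.
  have dfin : diam (U i) \is a fin_num.
    by rewrite ge0_fin_numE//; apply: le_lt_trans (U1 i) _; exact: ltry.
  pose D := fine (diam (U i)).
  have D0 : 0 <= D by exact: fine_ge0.
  have D1 : D <= 1 by rewrite -lee_fin fineK.
  exists `[x0 - c * D `^ s, x0 + c * D `^ s]%classic; split.
  - exact: measurable_itv.
  - move=> x x01 Ux; rewrite /= in_itv/= -ler_distl.
    apply: (le_trans (Gc x x0 x01 x001)); apply: ler_wpM2l; first exact: ltW.
    apply: ge0_ler_powR; rewrite ?nnegrE ?edist_ge0//; first exact: ltW.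
    by rewrite -lee_fin fineK// edist_le_diam.
  - have -> : hausdorff_gauge s' (U i) = (D `^ s')%:E.
      rewrite /hausdorff_gauge -poweR_EFin fineK//.
      by case: asboolP => // Ui0; rewrite Ui0 in Ux0.
    have DD : D `^ s <= D `^ s'.
      move: D0; rewrite le_eqVlt => /predU1P[<-|D0].
        by rewrite powR0 ?gt_eqF// powR_ge0.
      by apply: ger_powR; rewrite ?D0//; exact: ltW.
    rewrite lebesgue_measure_itv/= lte_fin; case: ifPn => _.
      rewrite -EFinB -EFinM lee_fin -mulrA mulrDl mul1r opprB addrC addrA subrK.
      by apply: lerD; apply: ler_wpM2l => //; exact: ltW.
    by rewrite -EFinM lee_fin mulr_ge0 ?powR_ge0// ltW.
(* By subadditivity 1 is at most the total length of the [W i], which is less than [2 * c] times its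
   inverse: a contradiction. *)
have W01 : (lebesgue_measure `[0%R, 1%R[%classic <=
    \sum_(0 <= i <oo) @lebesgue_measure R (W i))%E.
  apply: measure_sigma_subadditive.
  - by move=> i; have [] := HW i.
  - exact: measurable_itv.
  - move=> x; rewrite /= in_itv/= => x01.
    have [i _ Uix] := AU _ (GA x x01).
    by exists i => //; have [_ + _] := HW i; apply.
have : (1 < 1 :> \bar R)%E.
  apply: (@le_lt_trans _ _ (\sum_(0 <= i <oo) @lebesgue_measure R (W i))%E).
    by move: W01; rewrite lebesgue_measure_itv/= lte_fin ltr01 oppr0 adde0.
  apply: (@le_lt_trans _ _
      (\sum_(0 <= i <oo) ((2 * c)%:E * hausdorff_gauge s' (U i)))%E).
    by apply: lee_nneseries => // i _; have [] := HW i.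
  rewrite nneseriesZl; last by move=> *; exact: hausdorff_gauge_ge0.
  by rewrite -lte_pdivlMl// mule1.
by rewrite ltxx.
Qed.

(** * Binary digits *)

(** For x >= 0 this is the binary digit of weight 2^-(k+1); dyadic numbers get the expansion that
    ends in zeros. *)
Definition digit {R : realType} (x : R) (k : nat) : bool :=
  odd (Num.truncn (2 ^+ k.+1 * x)).

Lemma truncn_double (R : realType) (x : R) :
  0 <= x -> (Num.truncn (2 * x))./2 = Num.truncn x.
Proof.
move=> x0; apply/esym/eqP; rewrite truncn_eq//.
have /andP[] : (Num.truncn (2 * x))%:R <= 2 * x < (Num.truncn (2 * x)).+1%:R.
  by apply: truncn_itv; rewrite mulr_ge0.
set m := Num.truncn _ => mx xm.
have : m = (odd m + m./2 + m./2)%N by rewrite -addnA addnn odd_double_half.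
move: mx xm; set q := m./2; move: (odd m) => b mx xm mE.
move: mx xm; rewrite mE -!natr1 !natrD.
by case: b {mE} => /= *; apply/andP; split; lra.
Qed.

Lemma truncn_expS (R : realType) (x : R) k :
  0 <= x -> Num.truncn (2 ^+ k * x) = (Num.truncn (2 ^+ k.+1 * x))./2.
Proof. by move=> x0; rewrite exprS -mulrA truncn_double// mulr_ge0// exprn_ge0. Qed.

(** On [0, 1) the integer part of 2^n x encodes the first n digits, since passing from n to n + 1
    doubles it and adds the next digit. Agreement of prefixes thus becomes an equality of natural
    numbers. *)
Lemma digit_eq_truncn (R : realType) (x y : R) n :
  0 <= x < 1 -> 0 <= y < 1 -> (forall k, (k < n)%N -> digit x k = digit y k) ->
  Num.truncn (2 ^+ n * x) = Num.truncn (2 ^+ n * y).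
Proof.
move=> /andP[x0 x1] /andP[y0 y1]; elim: n => [_|n IH xy].
  by rewrite !mul1r !(@truncn_def _ _ 0%N)// ?x0 ?y0.
rewrite -[LHS]odd_double_half -[RHS]odd_double_half -!truncn_expS//.
rewrite [X in (_ + X.*2)%N]IH => [|k kn]; last by rewrite xy// ltnW.
by congr (nat_of_bool _ + _)%N; exact: (xy n).
Qed.

Lemma truncn_eq_digit (R : realType) (x y : R) n :
  0 <= x -> 0 <= y -> Num.truncn (2 ^+ n * x) = Num.truncn (2 ^+ n * y) ->
  forall k, (k < n)%N -> digit x k = digit y k.
Proof.
move=> x0 y0; elim: n => // n IH xy k; rewrite ltnS leq_eqVlt => /predU1P[->|].
  by rewrite /digit xy.
by apply: IH; rewrite !(truncn_expS _ _ n)// xy.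
Qed.

Lemma truncn_eq_dist (R : realType) (x y : R) n :
  0 <= x -> 0 <= y -> Num.truncn (2 ^+ n * x) = Num.truncn (2 ^+ n * y) ->
  `|x - y| < 2 ^- n.
Proof.
move=> x0 y0 xy.
have n0 : (0 : R) < 2 ^+ n by rewrite exprn_gt0.
have /truncn_itv/andP[x1 x2] : 0 <= 2 ^+ n * x by rewrite mulr_ge0// ltW.
have /truncn_itv/andP[y1 y2] : 0 <= 2 ^+ n * y by rewrite mulr_ge0// ltW.
rewrite -[X in _ < X]mulr1 -ltr_pdivrMl ?invr_gt0// invrK.
rewrite -[X in X * _](gtr0_norm n0) -normrM mulrBr ltr_norml.
move: x1 x2 y1 y2; rewrite xy -natr1 => *; apply/andP; split; lra.
Qed.

Lemma digit_inj (R : realType) (x y : R) :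
  0 <= x < 1 -> 0 <= y < 1 -> x != y -> exists k, digit x k != digit y k.
Proof.
move=> x01 y01 xy; apply: contrapT => /forallNP xyk.
have xyE k : digit x k = digit y k by apply/eqP/negPn/negP; exact: xyk.
have d0 : 0 < `|x - y| by rewrite normr_gt0 subr_eq0.
(* This [n] exceeds 1 / |x - y|, and 2^n > n, so 2^-n < |x - y|, whereas equal digits force |x - y|
   < 2^-n. *)
pose n := (Num.truncn `|x - y|^-1).+1.
have : `|x - y|^-1 < 2 ^+ n.
  apply: lt_trans (truncnS_gt _) _; rewrite -natrX ltr_nat; exact: ltn_expl.
rewrite -ltf_pV2 ?posrE ?exprn_gt0 ?invr_gt0// invrK => /lt_trans.
move/(_ _ (truncn_eq_dist _ _ _ n _ _ _)).
case/andP: (x01) (y01) => x0 _ /andP[y0 _].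
by move=> /(_ x0 y0 (digit_eq_truncn _ _ _ _ x01 y01 (fun k _ => xyE k))); rewrite ltxx.
Qed.

(** For 0 < r < 1/2 the values over all [b] form the self-similar Cantor set of ratio r in
    [0, 1 / (1 - r)]. *)
Definition digit_sum {R : realType} (r : R) (b : nat -> bool) : R :=
  limn (series (fun j => (b j)%:R * r ^+ j)).

Lemma is_cvg_digit_sum (R : realType) (r : R) (b : nat -> bool) :
  0 < r < 1 -> cvgn (series (fun j => (b j)%:R * r ^+ j)).
Proof.
move=> /andP[r0 r1].
apply: (@series_le_cvg _ _ (geometric 1 r)).
- by move=> n; rewrite mulr_ge0// exprn_ge0// ltW.
- by move=> n; rewrite /= mul1r exprn_ge0// ltW.
- by move=> n; rewrite /= ler_wpM2r ?exprn_ge0 ?lern1 ?leq_b1// ltW.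
- by apply: is_cvg_geometric_series; rewrite gtr0_norm.
Qed.

Lemma digit_sum_ge0 (R : realType) (r : R) (b : nat -> bool) :
  0 < r < 1 -> 0 <= digit_sum r b.
Proof.
move=> /[dup] r01 /andP[r0 r1]; apply: limr_ge; first exact: (is_cvg_digit_sum R r _ r01).
by near=> n; apply: sumr_ge0 => j _; rewrite mulr_ge0// exprn_ge0// ltW.
Unshelve. all: by end_near. Qed.

Lemma digit_sum_le (R : realType) (r : R) (b : nat -> bool) :
  0 < r < 1 -> digit_sum r b <= (1 - r)^-1.
Proof.
move=> /[dup] r01 /andP[r0 r1].
have nr1 : `|r| < 1 by rewrite gtr0_norm.
rewrite -[leRHS]mul1r -(cvg_lim _ (@cvg_geometric_series R 1 r nr1))//.
apply: lim_series_le; [exact: is_cvg_digit_sum|exact: is_cvg_geometric_series|].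
by move=> n; rewrite /= ler_wpM2r ?exprn_ge0 ?lern1 ?leq_b1// ltW.
Qed.

(** Self-similarity: a common leading digit cancels in a difference and leaves a factor [r]. Both
    distance estimates below are inductions on this. *)
Lemma digit_sumS (R : realType) (r : R) (b : nat -> bool) :
  0 < r < 1 -> digit_sum r b = (b 0%N)%:R + r * digit_sum r (b \o S).
Proof.
move=> r01; apply/cvg_lim => //; rewrite -cvg_shiftS.
have -> : [sequence series (fun j => (b j)%:R * r ^+ j) n.+1]_n =
    (fun n => (b 0%N)%:R + r * series (fun j => (b j.+1)%:R * r ^+ j) n).
  apply/funext => n; rewrite /series/= big_nat_recl// mulr1; congr (_ + _).
  by rewrite big_distrr/=; apply: eq_bigr => j _; rewrite exprS mulrCA.
by apply: cvgD; [exact: cvg_cst|apply: cvgMr; exact: is_cvg_digit_sum].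
Qed.

Lemma digit_sum_dist_le (R : realType) (r : R) n (b b' : nat -> bool) :
  0 < r < 1 -> (forall j, (j < n)%N -> b j = b' j) ->
  `|digit_sum r b - digit_sum r b'| <= r ^+ n / (1 - r).
Proof.
move=> /[dup] r01 /andP[r0 r1].
elim: n b b' => [|n IH] b b' bb'.
  have := digit_sum_ge0 R r b r01; have := digit_sum_le R r b r01.
  have := digit_sum_ge0 R r b' r01; have := digit_sum_le R r b' r01.
  by rewrite ler_norml mul1r => *; apply/andP; split; lra.
rewrite (digit_sumS R r b r01) (digit_sumS R r b' r01) bb'//.
rewrite opprD addrACA subrr add0r -mulrBr.
rewrite normrM gtr0_norm// exprS -mulrA; apply: ler_wpM2l; first exact: ltW.
by apply: IH => // j jn; rewrite /= bb'.
Qed.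

(** At the first differing digit one sum is at least 1 and the other at most r / (1 - r). The gap (1
    - 2 r) / (1 - r) is positive because 2 r < 1. *)
Lemma digit_sum_dist_ge (R : realType) (r : R) n (b b' : nat -> bool) :
  0 < r -> 2 * r < 1 -> (forall j, (j < n)%N -> b j = b' j) ->
  b n != b' n ->
  r ^+ n * ((1 - 2 * r) / (1 - r)) <= `|digit_sum r b - digit_sum r b'|.
Proof.
move=> r0 r2; have r01 : 0 < r < 1 by lra.
elim: n b b' => [|n IH] b b' bb' nbb'.
  rewrite mul1r (digit_sumS R r b r01) (digit_sumS R r b' r01).
  have h c : r * digit_sum r c <= r / (1 - r).
    by rewrite ler_wpM2l ?digit_sum_le// ltW.
  have h0 c : 0 <= r * digit_sum r c by rewrite mulr_ge0 ?digit_sum_ge0// ltW.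
  have -> : (1 - 2 * r) / (1 - r) = 1 - r / (1 - r) by field; lra.
  have := h (b \o S); have := h (b' \o S); have := h0 (b \o S); have := h0 (b' \o S).
  rewrite ler_normr; case: (b 0%N) (b' 0%N) nbb' => [] []//= _ *.
    by apply/orP; left; lra.
  by apply/orP; right; lra.
rewrite (digit_sumS R r b r01) (digit_sumS R r b' r01) bb'//.
rewrite opprD addrACA subrr add0r -mulrBr.
rewrite normrM gtr0_norm// exprS -mulrA; apply: ler_wpM2l; first exact: ltW.
by apply: IH => // j jn; rewrite /= bb'.
Qed.

(** * A Cantor set of prescribed dimension *)

(* The binary digits of x are dealt out cyclically to the d coordinates. *)
Definition cantor_point {R : realType} (d : nat) (r x : R) : 'rV[R]_d :=
  \row_(i < d) digit_sum r (fun j => digit x (j * d + i)).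

(** The first [n * d] digits of x supply the first [n] digits of every coordinate. *)
Lemma cantor_point_dist_le (R : realType) (d : nat) (r x y : R) n i :
  0 < r < 1 -> 0 <= x -> 0 <= y ->
  Num.truncn (2 ^+ (n * d) * x) = Num.truncn (2 ^+ (n * d) * y) ->
  `|cantor_point d r x 0 i - cantor_point d r y 0 i| <= r ^+ n / (1 - r).
Proof.
move=> r01 x0 y0 xy; rewrite !mxE; apply: digit_sum_dist_le => // j jn.
apply: truncn_eq_digit x0 y0 xy _ _.
by rewrite (@leq_trans (j.+1 * d)) ?leq_mul2r ?jn ?orbT// mulSn addnC ltn_add2r.
Qed.

(** The inverse of [cantor_point] is Hölder of exponent [s]. If digit k is the first to differ, then
    |x - y| < 2^-k, while coordinate k mod d differs at place n = k / d, which separates the points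
    by a multiple of r^n. As k >= n d, 2^-k is at most (r^n)^s. *)
Lemma cantor_point_dist_ge (R : realType) (d : nat) (r s x y : R) :
  (0 < d)%N -> 0 < s -> 0 < r -> 2 * r < 1 -> r `^ s = 2 ^- d ->
  0 <= x < 1 -> 0 <= y < 1 ->
  `|x - y| <= ((1 - r) / (1 - 2 * r)) `^ s *
              edist (cantor_point d r x) (cantor_point d r y) `^ s.
Proof.
move=> d0 s0 r0 r2 rs x01 y01.
have [->|xy] := eqVneq x y; first by rewrite subrr normr0 mulr_ge0 ?powR_ge0.
have [k xyk kmin] : exists2 k, digit x k != digit y k &
    forall j, (j < k)%N -> digit x j = digit y j.
  have [k xyk kmin] := ex_minnP (digit_inj _ _ _ x01 y01 xy).
  exists k => // j jk; apply/eqP/negPn/negP => /kmin.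
  by rewrite leqNgt jk.
have [/andP[x0 x1] /andP[y0 y1]] := (x01, y01).
set n := (k %/ d)%N; have ild : (k %% d < d)%N by rewrite ltn_mod.
pose i := Ordinal ild.
have xyn : `|x - y| <= (r ^+ n) `^ s.
  have xyE := digit_eq_truncn _ _ _ _ x01 y01 kmin.
  apply: le_trans (ltW (truncn_eq_dist _ _ _ _ x0 y0 xyE)) _.
  rewrite -powR_mulrn ?(ltW r0)// powRAC powR_mulrn ?powR_ge0// rs exprVn -exprM.
  by rewrite lef_pV2 ?posrE ?exprn_gt0// ler_eXn2l ?ltr1n// mulnC leq_divM.
have dge : r ^+ n * ((1 - 2 * r) / (1 - r)) <=
    edist (cantor_point d r x) (cantor_point d r y).
  apply: le_trans (coord_le_edist R d _ _ i); rewrite !mxE.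
  apply: digit_sum_dist_ge => //; last by rewrite -divn_eq.
  move=> j jn; apply: kmin; rewrite (divn_eq k d) -/n ltn_add2r ltn_mul2r d0.
  exact: jn.
have r1 : 0 < 1 - r by lra.
have r3 : 0 < 1 - 2 * r by lra.
have r13 : 0 <= (1 - r) / (1 - 2 * r) by rewrite divr_ge0// ltW.
rewrite (le_trans xyn)// -powRM ?edist_ge0//.
apply: ge0_ler_powR; rewrite ?nnegrE ?(mulr_ge0 r13) ?exprn_ge0 ?edist_ge0//.
- exact: ltW.
- exact: ltW.
- by rewrite -ler_pdivrMl ?divr_gt0// invf_div mulrC.
Qed.

(** A closed ball of the sup norm, written as a product of segments so that compactness is inherited
    from them. *)
Definition cube {R : realType} {d : nat} (p : 'rV[R]_d) (rho : R) : set 'rV[R]_d :=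
  [set x | forall i, `[p 0 i - rho, p 0 i + rho]%classic (x 0 i)].

Lemma cubeP (R : realType) (d : nat) (p : 'rV[R]_d) (rho : R) (x : 'rV[R]_d) :
  cube p rho x <-> forall i, `|x 0 i - p 0 i| <= rho.
Proof. by split=> H i; have := H i; rewrite /= in_itv/= -ler_distl. Qed.

Lemma compact_cube (R : realType) (d : nat) (p : 'rV[R]_d) (rho : R) :
  compact (cube p rho).
Proof.
apply: (@rV_compact R d (fun i => `[p 0 i - rho, p 0 i + rho]%classic)) => i.
exact: segment_compact.
Qed.

Lemma closed_cube (R : realType) (d : nat) (p : 'rV[R]_d) (rho : R) :
  closed (cube p rho).
Proof.
apply: compact_closed; last exact: compact_cube.
exact: norm_hausdorff.
Qed.

Lemma edist_cube (R : realType) (d : nat) (p : 'rV[R]_d) (rho : R) x y :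
  0 <= rho -> cube p rho x -> cube p rho y -> edist x y <= d%:R * (2 * rho).
Proof.
move=> rho0 /cubeP px /cubeP py; apply: edist_le => [|i]; first by rewrite mulr_ge0.
rewrite (le_trans (ler_distD (p 0 i) _ _))// mulrDl mul1r lerD//.
by rewrite distrC.
Qed.

(** The image need not be closed, because expansions ending in ones do not occur. A finite union of
    closed cubes that covers it also covers its closure. *)
Lemma closure_cantor_sub (R : realType) (d : nat) (r : R) n :
  0 < r < 1 ->
  closure (cantor_point d r @` [set x | 0 <= x < 1]) `<=`
  \bigcup_(m in `I_(2 ^ (n * d)))
     cube (cantor_point d r (m%:R / 2 ^+ (n * d))) (r ^+ n / (1 - r)).
Proof.
move=> r01; rewrite closureE; apply: smallest_sub.
  by apply: closed_bigcup => [|m _]; [exact: finite_II|exact: closed_cube].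
move=> _ [x /andP[x0 x1] <-].
have n0 : (0 : R) < 2 ^+ (n * d) by rewrite exprn_gt0.
have x20 : 0 <= 2 ^+ (n * d) * x by rewrite mulr_ge0// ltW.
(* The centre for x is the image of its dyadic truncation, which shares its first [n * d] digits. *)
exists (Num.truncn (2 ^+ (n * d) * x)).
  by rewrite /= truncn_lt_nat// natrX gtr_pMr.
apply/cubeP => i; apply: cantor_point_dist_le => //.
by rewrite [X in _ = Num.truncn X]mulrC divfK ?gt_eqF// natrK.
Qed.

Lemma compact_closure_cantor (R : realType) (d : nat) (r : R) :
  0 < r < 1 -> compact (closure (cantor_point d r @` [set x | 0 <= x < 1])).
Proof.
move=> r01.
apply: (subclosed_compact _ (compact_cube _ _ (cantor_point d r 0) (1 - r)^-1)).
  exact: closed_closure.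
(* At level 0 the cover is a single cube. *)
have := closure_cantor_sub R d r 0 r01.
rewrite mul0n expn0 expr0 II1 bigcup_set1 mul0r !mul1r.
exact.
Qed.

Lemma geometric_lt (R : realType) (K z e : R) : 0 <= z < 1 -> 0 < e ->
  \forall n \near \oo, K * z ^+ n < e.
Proof.
move=> /andP[z0 z1] e0; have z1' : `|z| < 1 by rewrite ger0_norm.
have := @cvg_geometric R K z z1'.
by move=> /cvgr_lt; apply.
Qed.

(** The Hölder inverse gives the lower bound and the covers by 2^(n d) cubes of size comparable to
    r^n the upper one. Allowing any countable [B] lets the grids be added later. *)
Lemma compact_hausdorff_dim (R : realType) (d : nat) (s : R) :
  0 <= s -> s < d%:R ->
  exists2 C : set 'rV[R]_d, compact C &
    forall B, countable B -> hausdorff_dim (C `|` B) = s%:E.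
Proof.
rewrite le_eqVlt => /predU1P[<- _|s0 sd].
  (* For s = 0 the ratio below would divide by 0; here the countable set alone has dimension 0. *)
  exists set0; first exact: compact0.
  move=> B cB; apply/eqP; rewrite eq_le hausdorff_dim_ge0 andbT.
  apply: hausdorff_dim_le => // t t0; apply: (hausdorff_measure_eq0 _ _ _ _ B) => //.
  move=> delta e delta0 e0; exists 0%N, (fun=> set0), 0; split => //.
  - by rewrite set0U; exact: subsetUr.
  - exact: ltW.
  - by rewrite mul0r ltW.
have d0 : (0 < d)%N by rewrite -(ltr_nat R); exact: lt_trans sd.
(* The solution of 2^d r^s = 1; the condition r < 1/2 amounts to s < d. *)
pose r : R := 2 `^ (- (d%:R / s)).
have r0 : 0 < r by exact: powR_gt0.
have rs : r `^ s = 2 ^- d.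
  by rewrite -powRrM mulNr divfK ?gt_eqF// powR_invn.
have r2 : 2 * r < 1.
  rewrite -ltr_pdivlMl// mulr1 -powR_inv1// /r.
  rewrite /powR pnatr_eq0/= ltr_expR ltr_pM2r ?ln_gt0 ?ltr1n//.
  by rewrite ltrN2 ltr_pdivlMr// mul1r.
have r01 : 0 < r < 1 by lra.
have [_ r1] := andP r01.
exists (closure (cantor_point d r @` [set x | 0 <= x < 1])).
  exact: compact_closure_cantor.
move=> B cB; apply/eqP; rewrite eq_le; apply/andP; split; last first.
  apply: (hausdorff_dim_ge R d s (((1 - r) / (1 - 2 * r)) `^ s) _ (cantor_point d r)) => //.
  - by rewrite powR_gt0// divr_gt0//; lra.
  - by move=> x x01; left; apply: subset_closure; exists x.
  - by move=> x y x01 y01; exact: cantor_point_dist_ge.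
apply: hausdorff_dim_le => [|s' ss']; first exact: ltW.
have s'0 : 0 < s' by exact: lt_trans ss'.
apply: (hausdorff_measure_eq0 _ _ _ _ B) => // delta e delta0 e0.
pose K := d%:R * (2 / (1 - r)).
have K0 : 0 <= K by rewrite mulr_ge0// divr_ge0//; lra.
(* 2^(n d) cubes of diameter at most K r^n contribute at most K^s' q^n, and q < 1 because r^s' < r^s
   = 2^-d. *)
pose q := 2 ^+ d * r `^ s'.
have q01 : 0 <= q < 1.
  rewrite mulr_ge0 ?exprn_ge0 ?powR_ge0//=.
  rewrite -ltr_pdivlMl ?exprn_gt0// mulr1 -rs.
  by rewrite /powR gt_eqF// ltr_expR ltr_nM2r// ln_lt0.
have r01' : 0 <= r < 1 by rewrite ltW.
have [n [n1 n2]] : exists n, K * r ^+ n < delta /\ K `^ s' * q ^+ n < e.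
  near \oo => n; exists n; split; near: n; exact: geometric_lt.
exists (2 ^ (n * d))%N,
  (fun m => cube (cantor_point d r (m%:R / 2 ^+ (n * d))) (r ^+ n / (1 - r))),
  (K * r ^+ n); split.
- by apply: setSU; exact: closure_cantor_sub.
- move=> m _ x y mx my; rewrite (le_trans (edist_cube _ _ _ _ _ _ _ mx my))//.
    by rewrite divr_ge0 ?exprn_ge0//; lra.
  by rewrite /K -!mulrA ler_wpM2l// [X in 2 * X]mulrC.
- by rewrite mulr_ge0// exprn_ge0// ltW.
- exact: ltW.
- apply: le_trans (ltW n2); rewrite powRM ?exprn_ge0 ?(ltW r0)//.
  rewrite -powR_mulrn ?(ltW r0)// powRAC powR_mulrn ?powR_ge0//.
  by rewrite /q exprMn -exprM mulrCA natrX mulnC.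
Unshelve. all: by end_near. Qed.

(** * Countable compact sets of large Minkowski dimension *)

(** If a filter on [A] does not cluster at [a], one of its members misses a neighbourhood [U] of
    [a]. The filter then lives on the finite set [A] minus [U] and clusters there. *)
Lemma compact_finite_outside_nbhs (T : topologicalType) (A : set T) (a : T) :
  A a -> (forall U, nbhs a U -> finite_set (A `\` U)) -> compact A.
Proof.
move=> Aa finA F PF FA; apply: contrapT => Anc.
have [V [U [FV aU VU]]] : exists V U, [/\ F V, nbhs a U & V `&` U = set0].
  apply: contrapT => nVU; apply: Anc; exists a; split=> // V U FV aU.
  by apply/set0P/negP => /eqP VU; apply: nVU; exists V, U.
have FAU : F (A `\` U).
  apply: filterS (filterI FA FV) => x [Ax Vx]; split=> // Ux.
  by have : (V `&` U) x by []; rewrite VU.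
have [x [[Ax _] Fx]] := finite_compact (finA U aU) PF FAU.
by apply: Anc; exists x.
Qed.

(** Points in one closed ball of radius [delta] differ by at most 2 [delta] in each coordinate, so
    assigning to each [P i] a centre near it is injective. *)
Lemma covering_number_ge (R : realType) (n : nat) (A : set 'rV[R]_n) (delta : R)
    (I : finType) (P : I -> 'rV[R]_n) :
  (forall i, A (P i)) ->
  (forall i j, i != j -> exists k, 2 * delta < `|P i 0 k - P j 0 k|) ->
  (#|I|%:R%:E <= covering_number A delta)%E.
Proof.
move=> AP Psep; apply: le_ereal_inf_tmp => _ [c Ac <-]; rewrite lee_fin ler_nat.
have /(@choice _ _ (fun i y => y \in c /\ edist (P i) y <= delta))[f fP] :
    forall i, exists y, y \in c /\ edist (P i) y <= delta.
  by move=> i; have [y yc Py] := Ac _ (AP i); exists y.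
have finj : injective f.
  move=> i j fij; apply/eqP/negPn/negP => /Psep[k].
  apply/negP; rewrite -leNgt (le_trans (ler_distD (f i 0 k) _ _))//.
  rewrite mulrDl mul1r lerD//.
    by rewrite (le_trans (coord_le_edist _ _ _ _ _))//; case: (fP i).
  by rewrite distrC fij (le_trans (coord_le_edist _ _ _ _ _))//; case: (fP j).
rewrite cardE -(size_map f); apply: uniq_leq_size.
  by rewrite map_inj_uniq// enum_uniq.
by move=> _ /mapP[i _ ->]; case: (fP i).
Qed.

Lemma upper_minkowski_dim_ge (R : realType) (n : nat) (A : set 'rV[R]_n)
    (delta : nat -> R) (theta : \bar R) :
  (forall k, 0 < delta k) -> delta @ \oo --> 0 ->
  (\forall k \near \oo, (theta <=
     lne (covering_number A (delta k)) / lne ((delta k)^-1)%:E)%E) ->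
  (theta <= upper_minkowski_dim A)%E.
Proof.
move=> delta0 cdelta thetale; apply: le_ereal_inf_tmp => _ [V [e /= e0 Ve] <-].
have de : \forall k \near \oo, ball 0 e (delta k).
  exact: cdelta _ (nbhsx_ballx _ _ e0).
near \oo => k.
apply: (@le_trans _ _
    (lne (covering_number A (delta k)) / lne ((delta k)^-1)%:E)%E).
  by near: k.
apply: ereal_sup_ubound; exists (delta k) => //.
by apply: Ve => //; near: k.
Unshelve. all: by end_near. Qed.

(** Level n has 2^(n^2) points per direction at spacing 2^-(n^2 + n). Its side is below 2^-n, so the
    levels shrink to (1, ..., 1), while n is negligible against n^2 when points are counted. All
    coordinates are at least 1, hence invertible. *)
Definition grid_point {R : realType} (d n : nat) (v : 'I_d -> nat) : 'rV[R]_d :=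
  \row_i (1 + (v i)%:R / 2 ^+ (n * n + n)).

(** Finitely supported index functions make the ambient type countable, and with it every image of
    this set. *)
Definition grid_index (d : nat) : set (nat * {ffun 'I_d -> nat}) :=
  [set q : nat * {ffun 'I_d -> nat} | forall i, (q.2 i < 2 ^ (q.1 * q.1))%N].

Lemma finite_grid_index (d N : nat) :
  finite_set (grid_index d `&` [set q : nat * _ | (q.1 < N)%N]).
Proof.
apply: (@sub_finite_set _ _ (\bigcup_(n in `I_N)
    range (fun v : {ffun 'I_d -> 'I_(2 ^ (n * n))} => (n, [ffun i => nat_of_ord (v i)])))).
  move=> [n v] [/= vn nN]; exists n => //.
  exists [ffun i => Ordinal (vn i)] => //; congr pair.
  by apply/ffunP => i; rewrite !ffunE.
by apply: bigcup_finite => // n _; exact: finite_image.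
Qed.

(** Only finitely many levels can leave a given neighbourhood of [a]. The limit [a] belongs to the
    image, being the single point of level 0. The general [f] serves both the grids and their images
    under [inverse_point]. *)
Lemma compact_grid_image (R : realType) (d : nat)
    (f : nat * {ffun 'I_d -> nat} -> 'rV[R]_d) (a : 'rV[R]_d) :
  f (0%N, [ffun=> 0%N]) = a ->
  (forall q i, grid_index d q -> `|a 0 i - f q 0 i| <= 2 ^- q.1) ->
  compact (f @` grid_index d).
Proof.
move=> fa flim; apply: (compact_finite_outside_nbhs _ _ a).
  by exists (0%N, [ffun=> 0%N]) => // i; rewrite ffunE.
move=> U /nbhs_ballP[e /= e0 aU].
pose N := (Num.truncn e^-1).+1.
have Ne : 2 ^- N < e.
  rewrite -[e]invrK ltf_pV2 ?posrE ?exprn_gt0 ?invr_gt0//.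
  apply: lt_trans (truncnS_gt _) _; rewrite -natrX ltr_nat; exact: ltn_expl.
apply: sub_finite_set (finite_image f (finite_grid_index d N)).
move=> _ [[q Dq <-] nUfq]; exists q => //; split=> //=.
rewrite ltnNge; apply/negP => Nq; apply: nUfq; apply: aU.
split=> // i j; rewrite ord1 /ball/=; apply: le_lt_trans (flim _ _ Dq) _.
apply: le_lt_trans Ne.
by rewrite lef_pV2 ?posrE ?exprn_gt0// ler_eXn2l ?ltr1n.
Qed.

Lemma grid_offset_le (R : realType) (d : nat) q (i : 'I_d) :
  grid_index d q -> (q.2 i)%:R / 2 ^+ (q.1 * q.1 + q.1) <= 2 ^- q.1 :> R.
Proof.
move=> /(_ i) qi; rewrite exprD invfM mulrA ler_piMl ?invr_ge0 ?exprn_ge0//.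
by rewrite ler_pdivrMr ?exprn_gt0// mul1r -natrX ler_nat ltnW.
Qed.

Definition inverse_point {R : realType} {d : nat} (x : 'rV[R]_d.+1) : 'rV[R]_d.+1 :=
  (x 0 0)^-1 *: evec R 0.

Lemma dot_inverse_point (R : realType) (d : nat) (x : 'rV[R]_d.+1) :
  x 0 0 != 0 -> dot x (inverse_point x) = 1.
Proof.
move=> x0; have -> : dot x (inverse_point x) = (x 0 0)^-1 * dot x (evec R 0).
  rewrite /dot mulr_sumr; apply: eq_bigr => i _.
  by rewrite /inverse_point mxE mulrCA.
by rewrite dotC dot_evec mulVf.
Qed.

Definition grid_set (R : realType) (d : nat) : set 'rV[R]_d :=
  (fun q => grid_point d q.1 q.2) @` grid_index d.

Lemma compact_grid_set (R : realType) (d : nat) : compact (grid_set R d).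
Proof.
apply: (compact_grid_image _ _ _ (\row_i 1)).
  by apply/rowP => i; rewrite !mxE ffunE mul0r addr0.
move=> q i Dq; rewrite !mxE opprD addrA subrr add0r normrN ger0_norm.
  exact: grid_offset_le.
by rewrite divr_ge0// exprn_ge0.
Qed.

(** With first coordinate 1 + h, the image lies at distance h / (1 + h) <= h from [evec R 0], so the
    estimate for the grids carries over. *)
Lemma compact_inverse_grid_set (R : realType) (d : nat) :
  compact (inverse_point @` grid_set R d.+1).
Proof.
rewrite /grid_set image_comp.
apply: (compact_grid_image _ _ _ (evec R 0)).
  by rewrite /= /inverse_point mxE ffunE mul0r addr0 invr1 scale1r.
move=> q i Dq; rewrite /= /inverse_point !mxE eqxx/=.
set h := _ / _; have h0 : 0 <= h by rewrite divr_ge0// exprn_ge0.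
have hq : h <= 2 ^- q.1 by exact: grid_offset_le.
clearbody h; have h1 : 0 <= h / (1 + h) by rewrite divr_ge0// addr_ge0.
have -> : (i == 0)%:R - (1 + h)^-1 * (i == 0)%:R = (i == 0)%:R * (h / (1 + h)) :> R.
  by field; lra.
rewrite ger0_norm ?(mulr_ge0 _ h1)//.
apply: le_trans hq; apply: (@le_trans _ _ (h / (1 + h))).
  by rewrite ler_piMl// lern1 leq_b1.
by rewrite ler_pdivrMr ?ler_peMr//; lra.
Qed.

Lemma countable_grid_set (R : realType) (d : nat) : countable (grid_set R d).
Proof. exact: card_le_trans (card_image_le _ _) (countableP _). Qed.

Lemma natr_dist_ge1 (R : realType) (m n : nat) : m != n -> 1 <= `|m%:R - n%:R| :> R.
Proof.
by case: ltngtP => // mn _; rewrite ler_normr ?opprB !lerBrDl !natr1 !ler_nat mn ?orbT.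
Qed.

(** At scale 2^-(n^2 + n + 2), level n provides 2^(n^2 (d+1)) separated points of the incidence set,
    and n^2 (d+1) / (n^2 + n + 2) tends to d + 1. *)
Lemma minkowski_incidence_grid_ge (R : realType) (d : nat) (E : set 'rV[R]_d.+1)
    (theta : R) :
  grid_set R d.+1 `<=` E -> inverse_point @` grid_set R d.+1 `<=` E ->
  theta < d.+1%:R ->
  (theta%:E <= upper_minkowski_dim (incidence_set dot 1 E))%E.
Proof.
move=> KE fKE thetad.
(* The extra 2 makes 2 [delta n] half the grid spacing, so the separation is strict. *)
pose delta n : R := 2 ^- (n * n + n + 2).
have delta0 n : 0 < delta n by rewrite invr_gt0 exprn_gt0.
apply: (upper_minkowski_dim_ge _ _ _ delta) => //.
  apply: (@squeeze_cvgr _ _ _ _ (fun=> 0) (fun n => 2^-1 ^+ n)).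
  - near=> n; rewrite ltW//= /delta -exprVn ler_wiXn2l ?invr_ge0 ?invf_le1 ?ler1n//.
    lia.
  - exact: cvg_cst.
  - by apply: cvg_expr; rewrite ger0_norm ?invr_ge0 ?invf_lt1// ltr1n.
near=> n.
have Nge : ((2 ^ (n * n * d.+1))%:R%:E <=
    covering_number (incidence_set dot 1 E) (delta n))%E.
  have -> : (2 ^ (n * n * d.+1))%N = #|{ffun 'I_d.+1 -> 'I_(2 ^ (n * n))}|.
    by rewrite card_ffun !card_ord expnM.
  pose p (v : {ffun 'I_d.+1 -> 'I_(2 ^ (n * n))}) : 'rV[R]_d.+1 :=
    grid_point d.+1 n (fun i => v i).
  apply: (covering_number_ge _ _ _ _ _ (fun v => row_mx (p v) (inverse_point (p v)))).
    move=> v.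
    have Kp : grid_set R d.+1 (p v).
      exists (n, [ffun i => nat_of_ord (v i)]) => [i|].
        by rewrite ffunE ltn_ord.
      by apply/rowP => i; rewrite !mxE ffunE.
    exists (p v, inverse_point (p v)) => //; split; first exact: KE.
    split; first by apply: fKE; exists (p v).
    apply: dot_inverse_point; rewrite mxE gt_eqF// ltr_pwDl// divr_ge0//.
  move=> v w vw; have [k vwk] : exists k, v k != w k.
    apply/existsP; rewrite -negb_forall; apply: contra vw => /forallP vw.
    by apply/eqP/ffunP => k; apply/eqP.
  (* The first half of the pair, the grid point itself, already separates. *)
  exists (lshift d.+1 k); rewrite !row_mxEl !mxE opprD addrACA subrr add0r.
  rewrite -mulrBl normrM [X in _ < _ * X]ger0_norm ?invr_ge0 ?exprn_ge0//.
  apply: (@lt_le_trans _ _ (2 ^- (n * n + n))).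
    rewrite /delta exprD invfM mulrCA gtr_pMr ?invr_gt0 ?exprn_gt0//.
    by rewrite expr2; lra.
  rewrite ler_peMl ?invr_ge0 ?exprn_ge0//.
  exact: natr_dist_ge1.
have M0 : (0 < n * n + n + 2)%N by rewrite addnS.
rewrite /delta invrK lne_EFin ?exprn_gt0// lnXn// inver gt_eqF; last first.
  by rewrite pmulrn_lgt0// ln_gt0// ltr1n.
rewrite lee_pdivlMr ?pmulrn_lgt0// ?ln_gt0 ?ltr1n//.
have Nd0 : (0 < 2 ^ (n * n * d.+1))%N by rewrite expn_gt0.
apply: (@le_trans _ _ (lne (2 ^ (n * n * d.+1))%:R%:E)); last first.
  rewrite lee_lne// in_itv/= ?leey ?andbT ?lee_fin//.
  by apply: le_trans Nge; rewrite lee_fin.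
rewrite lne_EFin ?ltr0n// natrX lnXn// -EFinM lee_fin.
rewrite -[X in theta * X]mulr_natl -[leRHS]mulr_natl mulrA.
rewrite ler_wpM2r ?ln_ge0 ?ler1n// !natrD !natrM.
(* Writing D for d + 1: n^2 (D - theta) >= 2 D n >= D (n + 2) >= theta (n + 2), which is the
   required inequality. *)
have nX : 2 * d.+1%:R / (d.+1%:R - theta) <= n%:R by near: n; exact: nbhs_infty_ger.
have n2 : 2 <= n%:R :> R by near: n; exact: nbhs_infty_ger.
have dt : 0 < d.+1%:R - theta by rewrite subr_gt0.
rewrite ler_pdivrMr// in nX.
by nra.
Unshelve. all: by end_near. Qed.

Theorem theorem1p10 (R : realType) (d : nat) (hd : (2 <= d)%N) :
  exists (phi : 'rV[R]_d -> 'rV[R]_d -> R) (t : R),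
    rotational_curvature phi t /\
    forall s : R, 0 <= s -> s < (d%:R + 1) / 2 ->
      exists E : set 'rV[R]_d,
        [/\ compact E,
            hausdorff_dim E = s%:E
          & (2%:E * hausdorff_dim E - 1 <
             upper_minkowski_dim (incidence_set phi t E))%E].
Proof.
case: d hd => // d hd; exists (@dot R d.+1), 1; split.
  exact: rotational_curvature_dot.
move=> s s0 sd.
have d1 : (1 : R) < d.+1%:R by rewrite ltr1n.
have sd' : s < d.+1%:R by apply: lt_le_trans sd _; lra.
have [C cC Cdim] := compact_hausdorff_dim R d.+1 s s0 sd'.
pose K := grid_set R d.+1.
pose B := K `|` inverse_point @` K.
have cB : countable B.
  have cK : countable K by exact: countable_grid_set.
  rewrite /B -bigcup2E; apply: bigcup_countable => // -[|[|i]] _ //=.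
  exact: card_le_trans (card_image_le _ _) cK.
exists (C `|` B); split; [|exact: Cdim|].
  apply: compactU => //; apply: compactU; first exact: compact_grid_set.
  exact: compact_inverse_grid_set.
rewrite Cdim// -EFinM -EFinB.
(* The grid bound holds for exponents strictly below the dimension d + 1 of the space, so the
   midpoint between 2 s - 1 and d + 1 is used. *)
apply: (@lt_le_trans _ _ (((2 * s - 1) + d.+1%:R) / 2)%:E).
  by rewrite lte_fin; lra.
apply: minkowski_incidence_grid_ge; last by lra.
  by move=> x Kx; right; left.
by move=> x fKx; right; right.
Qed.
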